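(* Let $(T_t)_{t\geq 0}$ be a $C_0$-semigroup on a separable Banach space $X$. If $(T_t)_{t\ge 0}$ has the specification property for semigroups (SgSP), then $(T_t)_{t\ge 0}$ is frequently hypercyclic.
   Context: A $C_0$-semigroup on a Banach space $X$ is a family $(T_t)_{t\ge 0}$ of bounded linear operators on $X$ with $T_0=\mathrm{Id}$, $T_tT_s=T_{t+s}$ for all $t,s\ge 0$, and $\lim_{t\to s}T_tx=T_sx$ for all $x\in X$, $s\ge 0$. SgSP: A $C_0$-semigroup $(T_t)_{t\ge 0}$ on a separable Banach space $X$ has the SgSP if there exist an increasing sequence $(K_n)_{n\in\mathbb{N}}$ of subsets of $X$ with $0\in K_1$ and $\overline{\bigcup_{n} K_n}=X$, and a $t_0>0$, such that for each $n\in\mathbb{N}$ the set $K_n$ is $T_{t_0}$-invariant (i.e. $T_{t_0}(K_n)\subset K_n$), and for every $\delta>0$ there is $M_{\delta,n}>t_0$ such that for any integer $s\ge 2$, any set $\{y_1,\dots,y_s\}\subset K_n$ and any real numbers $0=a_1\le b_1<a_2\le b_2<\dots<a_s\le b_s$ satisfying $a_{r+1}-b_r\ge M_{\delta,n}$ for $r=1,\dots,s-1$, there is a point $x\in K_n$ such that - $\|T_t(x)-T_t(y_r)\|<\delta$ for each $t\in[a_r,b_r]$, $r=1,\dots,s$; - $T_{t'}(x)=x$, where $t'$ is the (unique) element of $[M_{\delta,n}+b_s,\,M_{\delta,n}+b_s+t_0)\cap \mathbb{N}\cdot t_0$, with $\mathbb{N}\cdot t_0=\{kt_0 : k\in\mathbb{N}\}$.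 Frequent hypercyclicity: $(T_t)_{t\ge 0}$ is frequently hypercyclic if there is $x\in X$ such that $\underline{\operatorname{Dens}}(\{t\ge 0: T_tx\in U\})>0$ for every non-empty open $U\subset X$, where for a Lebesgue measurable $B\subset[0,\infty)$, $\underline{\operatorname{Dens}}(B)=\liminf_{t\to\infty}\mu(B\cap[0,t])/t$ with $\mu$ the Lebesgue measure. *)

(* Defs.v *)
From mathcomp Require Import all_boot all_order all_algebra complex.
From mathcomp Require Import all_classical all_reals all_analysis.

Set Implicit Arguments.
Unset Strict Implicit.
Unset Printing Implicit Defensive.

Import Order.TTheory GRing.Theory Num.Theory.
Import numFieldNormedType.Exports.

Local Open Scope classical_set_scope.
Local Open Scope ring_scope.

(* A Banach space is real or complex: [scalar_field R b] is C = R[i] if [b]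
   holds, and R otherwise. *)
Definition scalar_field (R : realType) (b : bool) : numFieldType :=
  if b then (R[i]%C : numFieldType) else (R : numFieldType).

Definition separable (X : topologicalType) : Prop :=
  exists2 D : set X, countable D & dense D.

(* The family is indexed by all of R, but only the operators [T t] with
   [0 <= t] are constrained or used below. *)
Record is_C0_semigroup (R : realType) (K : numFieldType) (X : normedModType K)
    (T : R -> {linear X -> X}) : Prop := IsC0Semigroup {
  C0_bounded : forall t, 0 <= t -> bounded_near (T t) (nbhs (0 : X));
  C0_id : forall x, T 0 x = x;
  C0_comp : forall t s, 0 <= t -> 0 <= s -> forall x, T t (T s x) = T (t + s) x;
  C0_continuous : forall x,
    {within [set t : R | 0 <= t], continuous (fun t : R => T t x)}
}.

(* Everything is numbered from 0: [Kn 0] is the first set of the sequence, and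
   y_1, ..., y_s, a_1, ..., b_s are the first s values of [y], [a], [b].
   As M > 0, exactly one multiple of t0 lies in [M + b_s, M + b_s + t0), so the
   last clause concerns a single time t' = k * t0. A strictly positive [delta]
   in R[i] is a strictly positive real. *)
Definition SgSP (R : realType) (K : numFieldType) (X : normedModType K)
    (T : R -> {linear X -> X}) : Prop :=
  exists (Kn : nat -> set X) (t0 : R),
    [/\ forall m n : nat, (m <= n)%N -> Kn m `<=` Kn n,
        Kn 0%N 0,
        closure (\bigcup_n Kn n) = [set: X],
        0 < t0 &
        forall n : nat,
          T t0 @` Kn n `<=` Kn n /\
          forall delta : K, 0 < delta ->
          exists2 M : R, t0 < M &
            forall (s : nat) (y : nat -> X) (a b : nat -> R),
              (2 <= s)%N ->
              (forall r, (r < s)%N -> Kn n (y r)) ->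
              a 0%N = 0 ->
              (forall r, (r < s)%N -> a r <= b r) ->
              (forall r, (r.+1 < s)%N -> b r < a r.+1) ->
              (forall r, (r.+1 < s)%N -> M <= a r.+1 - b r) ->
              exists x : X,
                [/\ Kn n x,
                    forall r, (r < s)%N -> forall t, a r <= t <= b r ->
                      `|T t x - T t (y r)| < delta &
                    forall k : nat,
                      M + b s.-1 <= k%:R * t0 < M + b s.-1 + t0 ->
                      T (k%:R * t0) x = x]].

(* [lebesgue_measure] is total (the Lebesgue outer measure); the sets to which
   it is applied below are measurable. *)
Definition lower_density (R : realType) (B : set R) : \bar R :=
  limf_einf
    (fun t : R => (lebesgue_measure (B `&` `[0%R, t]) * (t^-1)%:E)%E)
    (pinfty_nbhs R).

Definition frequently_hypercyclic (R : realType) (K : numFieldType)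
    (X : normedModType K) (T : R -> {linear X -> X}) : Prop :=
  exists x : X, forall U : set X, open U -> U !=set0 ->
    (0 < lower_density [set t : R | (0 <= t)%R /\ U (T t x)])%E.

(* Main.v *)
(* SgSP yields, near any vector v, a point whose orbit is periodic with period
   m N t0, is close to v at time (m - 1) N t0, and is small on the first m - 2
   of the m blocks of length N t0; N is a multiple of any prescribed integer and
   m is arbitrary.  Given targets u_1, u_2, ..., each open set containing
   infinitely many of them, one builds periodic points z_i, of period p_i t0 and
   with z_{i+1} - z_i of this form for m = 2^(i+3), p_i dividing N, and
   v = u_{i+1} - z_i.  Since z_i is fixed by T at the hitting time of
   z_{i+1} - z_i, the orbit of z_{i+1} is close to u_{i+1} at that time, hence
   along an arithmetic progression of difference p_{i+1} t0.  The increments of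
   levels l > i are small on all blocks of length p_{i+1} t0 except a proportion
   at most 2^-(l+2), which come last in each period, so at least half of the
   first n blocks are good for all levels, for every n.  The limit x of z_i
   therefore visits a neighbourhood of u_{i+1} during a time interval of fixed
   length in each of these good blocks. *)

Require Import Defs.
From mathcomp Require Import all_boot all_order all_algebra complex.
From mathcomp Require Import all_classical all_reals all_analysis.
From mathcomp Require Import zify ring lra.

Set Implicit Arguments.
Unset Strict Implicit.
Unset Printing Implicit Defensive.

Import Order.TTheory GRing.Theory Num.Theory.
Import numFieldNormedType.Exports.

Local Open Scope classical_set_scope.
Local Open Scope ring_scope.

(** * Counting residues and bounding lower density *)

(** The counted residues come last in each period, so an incomplete period holds at most its
    proportional share. *)
Lemma count_tail_residues (D e n : nat) : (0 < D)%N -> (e <= D)%N ->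
  ((\sum_(k < n) (D - e <= k %% D)%N) * D <= e * n)%N.
Proof.
move=> D0 eD.
have -> : (\sum_(k < n) (D - e <= k %% D)%N
          = e * (n %/ D) + (n %% D - (D - e)))%N.
  elim: n => [|n IH]; first by rewrite big_ord0 div0n mod0n muln0.
  rewrite big_ord_recr/= {}IH.
  have lt_nD := ltn_pmod n D0; have En := divn_eq n D.
  have [nD|Dn] := ltnP (n %% D).+1 D.
    have -> : (n.+1 %/ D = n %/ D)%N.
      by rewrite {1}En -addnS divnMDl// (divn_small nD) addn0.
    have -> : (n.+1 %% D = (n %% D).+1)%N.
      by rewrite {1}En -addnS modnMDl (modn_small nD).
    by case: leqP => /= ?; lia.
  have En1 : n.+1 = ((n %/ D).+1 * D)%N by lia.
  have -> : (n.+1 %/ D = (n %/ D).+1)%N by rewrite {1}En1 mulnK.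
  have -> : (n.+1 %% D = 0)%N by rewrite {1}En1 modnMl.
  by rewrite mulnS; case: leqP => /= ?; lia.
have := ltn_pmod n D0; have := divn_eq n D.
move: (n %/ D)%N (n %% D)%N => q r -> rD.
have [Dr|rDe] := leqP (D - e) r; nia.
Qed.

Lemma lower_density_gt0 (R : realType) (S : set R) (tau eps : R)
    (w : nat -> R) (good : pred nat) :
  0 < tau -> 0 < eps ->
  (forall k, k%:R * tau <= w k /\ w k + eps <= k.+1%:R * tau) ->
  (forall k, good k -> `[w k, w k + eps[ `<=` S) ->
  (forall n, n <= 2 * \sum_(k < n) good k)%N ->
  (0 < lower_density S)%E.
Proof.
move=> tau0 eps0 wP goodS cnt.
(* Additivity is applied only to finite unions of good windows; monotonicity of the outer measure
   then passes to [S]. *)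
have V n : exists V : set R, [/\ measurable V,
    V `<=` S `&` `[0, n%:R * tau[ &
    lebesgue_measure V = ((\sum_(k < n) good k)%:R * eps)%:E].
  elim: n => [|n [V [mV VS muV]]].
    by exists set0; split; rewrite ?big_ord0 ?mul0r ?measure0//; exact: sub0set.
  have [w1 w2] := wP n.
  have n0 : 0 <= n%:R * tau by rewrite mulr_ge0// ltW.
  rewrite big_ord_recr/=; case: (boolP (good n)) => [gn|_]; last first.
    exists V; split; rewrite ?addn0// => x /VS[Sx]/=; rewrite !in_itv/=.
    move=> /andP[x0 xn]; split=> //.
    by rewrite x0 (lt_le_trans xn)// ler_pM2r// ler_nat.
  exists (V `|` `[w n, w n + eps[); split.
  - exact: measurableU.
  - move=> x [/VS[Sx]|]/=; rewrite !in_itv/= => /andP[x0 xn].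
      by split=> //; rewrite x0 (lt_le_trans xn)// ler_pM2r// ler_nat.
    split; first by apply: (goodS _ gn); rewrite /= in_itv/= x0.
    by rewrite (le_trans n0 (le_trans w1 x0)) (lt_le_trans xn).
  - have -> : lebesgue_measure (V `|` `[w n, w n + eps[) =
        (lebesgue_measure V + lebesgue_measure `[w n, (w n + eps)%R[)%E.
      apply: measureU => //.
      apply/seteqP; split=> // x [/VS[_]]/=; rewrite !in_itv/=.
      move=> /andP[_ xn] /andP[wx _].
      by have := lt_le_trans xn (le_trans w1 wx); rewrite ltxx.
    rewrite muV lebesgue_measure_itv/= lte_fin ltrDl eps0 /= -EFinD.
    by congr (_%:E); rewrite natrD mulrDl/= mul1r; lra.
(* For [n] the integer part of [t / tau], at least [n / 2] windows lie in [[0, t]] and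
   [t < (n + 1) tau <= 2 n tau]: hence the 4. *)
pose c := eps / (4 * tau).
have c0 : 0 < c by rewrite divr_gt0// mulr_gt0.
apply: (@lt_le_trans _ _ c%:E); first by rewrite lte_fin.
rewrite /lower_density limf_einfE; apply: le_ereal_sup_tmp.
pose f (t : R) := (lebesgue_measure (S `&` `[0%R, t]) * (t^-1)%:E)%E.
exists (ereal_inf (f @` [set t | tau < t])).
  by exists [set t | tau < t] => //; exists tau; split=> //; exact: num_real.
apply: le_ereal_inf_tmp => _ [t /= tt <-]; rewrite /f.
have t0 : 0 < t := lt_trans tau0 tt.
have /truncn_itv : 0 <= t / tau by rewrite divr_ge0// ltW.
set n := Num.truncn _ => /andP[n1 n2].
have {}n1 : n%:R * tau <= t by rewrite -ler_pdivlMr.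
have {}n2 : t < n.+1%:R * tau by rewrite -ltr_pdivrMr.
have n0 : (0 < n)%N.
  by case: n n1 n2 => // _; rewrite mul1r => /(lt_trans tt); rewrite ltxx.
have [V0 [mV VS muV]] := V n.
rewrite lee_pdivlMr//.
apply: (@le_trans _ _ (lebesgue_measure V0)); last first.
  apply: le_outer_measure => x /VS[Sx]/=; rewrite !in_itv/= => /andP[x0 xn].
  by split=> //; rewrite x0 ltW// (lt_le_trans xn).
rewrite muV -EFinM lee_fin.
have := cnt n; rewrite -(ler_nat R) natrM => cn.
have tn : t <= 2 * n%:R * tau.
  apply: (le_trans (ltW n2)); rewrite ler_pM2r// -natrM ler_nat; lia.
rewrite /c; apply: (@le_trans _ _ (eps / (4 * tau) * (2 * n%:R * tau))).
  by rewrite ler_wpM2l// ltW.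
have -> : eps / (4 * tau) * (2 * n%:R * tau) = n%:R / 2 * eps.
  by field; rewrite gt_eqF.
by rewrite ler_pM2r// ler_pdivrMr// mulrC.
Qed.

(** * Periodic points from specification *)

Lemma C0_periodic (R : realType) (K : numFieldType) (X : normedModType K)
    (T : R -> {linear X -> X}) (p : R) (z : X) :
  is_C0_semigroup T -> 0 <= p -> T p z = z ->
  forall (k : nat) t, 0 <= t -> T (t + k%:R * p) z = T t z.
Proof.
move=> C0 p0 pz; elim=> [|k IH] t t0; first by rewrite mul0r addr0.
rewrite -natr1 mulrDl mul1r addrA -(C0_comp C0) ?pz ?IH//.
by rewrite addr_ge0// mulr_ge0.
Qed.

(** Specification is applied twice in one [Kn n]: to make a point near [v] periodic, then to follow
    0 before switching to that periodic point. The gap [M] is fixed before [m], so one [N] serves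
    every [m]. *)
Lemma SgSP_periodic_shadow (R : realType) (K : numFieldType)
    (X : normedModType K) (T : R -> {linear X -> X}) :
  is_C0_semigroup T -> SgSP T ->
  exists2 t0 : R, 0 < t0 &
  forall (v : X) (d : K) (P : nat), 0 < d -> (0 < P)%N ->
  exists N : nat, [/\ (0 < N)%N, (P %| N)%N &
  forall m : nat, exists x : X,
    [/\ T ((m.+2 * N)%:R * t0) x = x,
        `|T ((m.+1 * N)%:R * t0) x - v| < d &
        forall t : R, 0 <= t <= (m * N)%:R * t0 -> `|T t x| < d]].
Proof.
move=> C0 [Kn [t0 [Kmono K00 Kdense t0_gt0 spec]]]; exists t0 => // v d P d0 P0.
have d30 : 0 < d / 3 by rewrite divr_gt0.
have : closure (\bigcup_n Kn n) v by rewrite Kdense.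
move=> /(_ _ (nbhsx_ballx v _ d30)) [y0 [[n _ Ky0]]].
rewrite -ball_normE /= => vy0.
have [_ /(_ _ d30) [M tM specM]] := spec n.
have M0 : 0 < M := lt_trans t0_gt0 tM.
have leBM c : exists B : nat, c <= B%:R * t0.
  exists (Num.bound (`|c| / t0)); rewrite -ler_pdivrMr//.
  apply: le_trans (ltW (archi_boundP _)); last by rewrite divr_ge0// ltW.
  by rewrite ler_pM2r ?invr_gt0// ler_norm.
(* This leaves room for the segments [[0, 0]] and [[M, k t0 - M]], after which the return time is
   exactly [k t0]. *)
have [k kM] := leBM (M + M).
have [y [Ky ysh yper]] : exists y : X,
    [/\ Kn n y, `|y - y0| < d / 3 & T (k%:R * t0) y = y].
  have [//|//|||||y [Ky yy0 /(_ k) yk]] :=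
      specM 2%N (fun=> y0) (fun r => r%:R * M)
    (fun r => if r == 0%N then 0 else k%:R * t0 - M).
  - by rewrite mul0r.
  - by move=> [|[|//]] _ /=; rewrite ?mul0r// mul1r; lra.
  - by move=> [|//] _ /=; rewrite mul1r.
  - by move=> [|//] _ /=; rewrite mul1r subr0.
  exists y; split=> //; last by apply: yk => /=; lra.
  by have := yy0 0%N isT 0; rewrite !(C0_id C0) /= mul0r lexx; exact.
have k0 : (0 < k)%N.
  by case: k kM {yper} => // ; rewrite mul0r; lra.
have [B BM] := leBM M.
have B0 : (0 < B)%N.
  by case: B BM => // ; rewrite mul0r; lra.
(* The factor [k] makes [N t0] a period of [y], and [B] makes it at least [M]. *)
exists (P * k * B)%N; split; [by rewrite !muln_gt0 P0 k0 |
  by rewrite -mulnA dvdn_mulr |].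
set N := (P * k * B)%N => m.
have NM : M <= N%:R * t0.
  apply: (le_trans BM); rewrite ler_pM2r// ler_nat leq_pmull//.
  by rewrite muln_gt0 P0.
have E1 : (m.+1 * N)%:R * t0 = (m * N)%:R * t0 + N%:R * t0.
  by rewrite -mulrDl -natrD mulSn addnC.
have E2 : (m.+2 * N)%:R * t0 = (m.+1 * N)%:R * t0 + N%:R * t0.
  by rewrite -mulrDl -natrD mulSn addnC.
have mN0 : 0 <= (m * N)%:R * t0 by rewrite mulr_ge0// ltW.
have m1N0 : 0 <= (m.+1 * N)%:R * t0 by rewrite mulr_ge0// ltW.
(* The last segment stops [M] early so that the return time is [(m + 2) N t0]. Shadowing 0 means
   staying small, as [T t 0 = 0]. *)
have [//||||||x [_ xsh /(_ (m.+2 * N)%N) xper]] := specM 2%N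
    (fun r => if r == 0%N then 0 else y)
    (fun r => if r == 0%N then 0 else (m.+1 * N)%:R * t0)
    (fun r => if r == 0%N then (m * N)%:R * t0 else (m.+2 * N)%:R * t0 - M).
- by move=> [|[|//]] _ //=; apply: (Kmono 0%N n) => //.
- by [].
- by move=> [|[|//]] _ //=; lra.
- by move=> [|//] _ /=; lra.
- by move=> [|//] _ /=; lra.
exists x; split.
- by apply: xper => /=; lra.
- have /(_ _) := xsh 1%N isT ((m.+1 * N)%:R * t0) => /(_ _)/=.
  have -> : T ((m.+1 * N)%:R * t0) y = y.
    have := C0_periodic C0 _ yper (m.+1 * (P * B)) (lexx 0).
    rewrite add0r (C0_id C0) mulrA -natrM.
    have -> : (m.+1 * (P * B) * k = m.+1 * N)%N.
      by rewrite /N -!mulnA [(B * k)%N]mulnC.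
    by apply; rewrite mulr_ge0// ltW.
  move=> H.
  have {}H : `|T ((m.+1 * N)%:R * t0) x - y| < d / 3 by apply: H; lra.
  have -> : T ((m.+1 * N)%:R * t0) x - v
     = (T ((m.+1 * N)%:R * t0) x - y) + (y - y0) - (v - y0).
    by rewrite addrA subrK opprB addrA subrK.
  apply: (le_lt_trans (ler_normB _ _)).
  have -> : d = d / 3 + d / 3 + d / 3 by field.
  by rewrite ltrD// (le_lt_trans (ler_normD _ _))// ltrD.
- move=> t tm; have := xsh 0%N isT t; rewrite raddf0 subr0 => /(_ tm) H.
  apply: (lt_le_trans H); rewrite ler_pdivrMr// ler_peMr// ?ler1n// ltW//.
Qed.

(** * Proportion of good blocks *)

Lemma leq_sum_dyadic (b : nat -> nat) (n m : nat) :
  (forall i, b i * 2 ^ i.+2 <= n)%N -> (2 * \sum_(i < m) b i <= n)%N.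
Proof.
move=> bn.
(* The induction carries [2 sum <= n (1 - 2^-m)], cleared of denominators. *)
suff H : ((\sum_(i < m) b i) * 2 * 2 ^ m + n <= n * 2 ^ m)%N.
  have : (0 < 2 ^ m)%N by rewrite expn_gt0.
  move: H; move: (\sum_(i < m) b i)%N (2 ^ m)%N => s q H q0.
  by rewrite -(leq_pmul2r q0); lia.
elim: m => [|m IH]; first by rewrite big_ord0 expn0; lia.
rewrite big_ord_recr/=; move: (bn m) IH; rewrite !expnS.
by move: (\sum_(i < m) b i)%N (2 ^ m)%N => s q; nia.
Qed.

(* [k] is bad at level [i] when the block [k * p, (k + 1) * p) meets the last
   [2 * N i] units of a period; as bad blocks come last in a period, at most a
   proportion [2 ^ - i.+2] of the [k < n] is bad, whatever [n]. *)
Lemma count_good_blocks (p h j : nat) (N : nat -> nat) :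
  (h < p)%N -> (forall i, (j <= i)%N -> (0 < N i)%N /\ (p %| N i)%N) ->
  forall n, (n <= 2 * \sum_(k < n) `[< forall i, (j <= i)%N ->
    (h + k * p) %% (2 ^ i.+3 * N i) < (2 ^ i.+3).-2 * N i >])%N.
Proof.
move=> hp NP n.
pose good k := `[< forall i, (j <= i)%N ->
  ((h + k * p) %% (2 ^ i.+3 * N i) < (2 ^ i.+3).-2 * N i)%N >].
rewrite -/(\sum_(k < n) good k)%N.
have p0 : (0 < p)%N by apply: leq_ltn_trans hp.
pose bad i k := ((2 ^ i.+3).-2 * N i <= (h + k * p) %% (2 ^ i.+3 * N i))%N.
have pow8 i : (8 <= 2 ^ i.+3)%N by rewrite (@leq_exp2l 2 3).
(* Union bound over the levels [j, ..., j + n - 1] only: for [i >= j + n], [h + k p < n p <= i p]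
   lies below the bad zone, as [N i >= p]. *)
have E : (n <= \sum_(k < n) good k + \sum_(i < n) \sum_(k < n) bad (j + i) k)%N.
  rewrite exchange_big -big_split/= -[leqLHS]card_ord -sum1_card.
  apply: leq_sum => k _; have [//|/asboolPn] := boolP (good k).
  move=> /existsNP[i /not_implyP[ji /negP]]; rewrite -leqNgt => badi.
  have [Ni0 /dvdnP[c Nic]] := NP i ji.
  have c0 : (0 < c)%N by case: c Nic => // Nic; rewrite Nic in Ni0.
  have iln : (i - j < n)%N.
    apply: contraLR badi; rewrite -leqNgt -ltnNge => nij.
    apply: leq_ltn_trans (leq_mod _ _) _.
    have : (i < (2 ^ i.+3).-2)%N.
      have := ltn_expl i.+3 (ltnSn 1); lia.
    have := ltn_ord k; rewrite Nic.
    move: (2 ^ i.+3).-2%N => w; nia.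
  rewrite (bigD1 (Ordinal iln))//= subnKC// /bad badi.
  by rewrite addnA addnC addnS.
(* Dividing by [p], with [N (j + i) = c p], turns badness into [k] having one of the last [2 c]
   residues modulo [2^(j+i+3) c]. *)
have badn i : ((\sum_(k < n) bad (j + i) k) * 2 ^ i.+2 <= n)%N.
  have [Ni0 /dvdnP[c Nic]] := NP (j + i)%N (leq_addr _ _).
  have c0 : (0 < c)%N by case: c Nic => // Nic; rewrite Nic in Ni0.
  have pw := pow8 (j + i)%N.
  have := @count_tail_residues (2 ^ (j + i).+3 * c) (2 * c) n.
  rewrite muln_gt0 expn_gt0 c0 leq_pmul2r// => /(_ isT).
  move=> /(_ (leq_trans _ pw)) => /(_ isT).
  have -> : (\sum_(k < n)
        (2 ^ (j + i).+3 * c - 2 * c <= k %% (2 ^ (j + i).+3 * c)))%N =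
      (\sum_(k < n) bad (j + i) k)%N.
    apply: eq_bigr => k _; congr nat_of_bool; rewrite /bad Nic.
    have -> : ((h + k * p) %% (2 ^ (j + i).+3 * (c * p)) =
               h + (k %% (2 ^ (j + i).+3 * c)) * p)%N.
      set D := (2 ^ (j + i).+3 * c)%N; rewrite mulnA -/D.
      have D0 : (0 < D)%N by rewrite muln_gt0 expn_gt0.
      rewrite {1}(divn_eq k D) mulnDl addnCA -mulnA modnMDl modn_small//.
      by have := ltn_pmod k D0; nia.
    move: (k %% _)%N pw => r; move: (2 ^ (j + i).+3)%N => w w8.
    by apply/idP/idP; nia.
  have -> : (2 ^ (j + i).+3 = 2 * (2 ^ j * 2 ^ i.+2))%N.
    by rewrite -expnD -expnS !addnS.
  have : (0 < 2 ^ j)%N by rewrite expn_gt0.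
  move: (\sum_(k < n) _)%N (2 ^ j)%N (2 ^ i.+2)%N => s a q a0 H.
  have : (s * (a * q) <= n)%N by nia.
  by nia.
by have := leq_sum_dyadic n badn; lia.
Qed.

(** * Recursive construction of the periodic approximants *)

Lemma periodic_approximants (R : realType) (K : numFieldType)
    (X : normedModType K) (T : R -> {linear X -> X}) (u : nat -> X) :
  is_C0_semigroup T -> SgSP T ->
  exists (t0 : R) (z : nat -> X) (p N : nat -> nat), 0 < t0 /\ forall i,
    [/\ (0 < N i)%N /\ (p i %| N i)%N,
        (0 < p i)%N /\ p i.+1 = (2 ^ i.+3 * N i)%N,
        T ((p i)%:R * t0) (z i) = z i,
        `|T ((p i.+1 - N i)%:R * t0) (z i.+1) - u i.+1| < 2^-1 ^+ i.+1 &
        forall t : R, 0 <= t <= ((2 ^ i.+3).-2 * N i)%:R * t0 ->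
          `|T t (z i.+1 - z i)| < 2^-1 ^+ i.+1].
Proof.
move=> C0 /(SgSP_periodic_shadow C0)[t0 t0_gt0 shadow].
pose inv (s : X * nat) := (0 < s.2)%N /\ T (s.2%:R * t0) s.1 = s.1.
pose step (i : nat) (s : X * nat) (N : nat) (s' : X * nat) :=
  [/\ (0 < N)%N /\ (s.2 %| N)%N, s'.2 = (2 ^ i.+3 * N)%N,
      `|T ((s'.2 - N)%:R * t0) s'.1 - u i.+1| < 2^-1 ^+ i.+1 &
      forall t : R, 0 <= t <= ((2 ^ i.+3).-2 * N)%:R * t0 ->
          `|T t (s'.1 - s.1)| < 2^-1 ^+ i.+1].
(* The invariant is a premise inside the existential, with a dummy value when it fails, so that
   [choice] yields a total step function. *)
have next (s : nat * (X * nat)) : exists s' : nat * (X * nat),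
    inv s.2 -> inv s'.2 /\ step s.1 s.2 s'.1 s'.2.
  case: s => i [z p]; rewrite /inv /step/=.
  have [[p0 pz]|ninv] := pselect ((0 < p)%N /\ T (p%:R * t0) z = z); last first.
    by exists (0%N, (z, p)) => /ninv.
  have d0 : 0 < 2^-1 ^+ i.+1 :> K by rewrite exprn_gt0// invr_gt0.
  have [N [N0 pN /(_ (2 ^ i.+3).-2)[x]]] := shadow (u i.+1 - z) _ p d0 p0.
  have pow8 : (8 <= 2 ^ i.+3)%N by rewrite (@leq_exp2l 2 3).
  have -> : ((2 ^ i.+3).-2.+2 = 2 ^ i.+3)%N by lia.
  have -> : ((2 ^ i.+3).-2.+1 * N = 2 ^ i.+3 * N - N)%N by nia.
  move=> [xper xhit xsmall].
  have fixz c : T ((c * N)%:R * t0) z = z.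
    have := C0_periodic C0 _ pz (c * (N %/ p)) (lexx 0).
    rewrite add0r (C0_id C0) mulrA -natrM -mulnA divnK//.
    by apply; rewrite mulr_ge0// ltW.
  exists (N, (z + x, (2 ^ i.+3 * N)%N)) => _ /=; split; split=> //=.
  - by rewrite muln_gt0 expn_gt0.
  - by rewrite raddfD/= xper fixz.
  - have E : (2 ^ i.+3 * N - N = (2 ^ i.+3).-1 * N)%N by nia.
    rewrite raddfD/= [in T _ z]E fixz.
    by move: xhit; rewrite opprB addrA (addrC z).
  - by move=> t /xsmall; rewrite addrAC subrr add0r.
have [F FP] := choice next.
(* The recursion starts at [z_0 = 0], of period [t0]. *)
pose st := fix st i := if i is j.+1 then (F (j, st j)).2 else (0, 1%N).
have inv_st i : inv (st i).
  elim: i => [|i IH]; first by split=> //=; rewrite raddf0.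
  by have [] := FP (i, st i) IH.
exists t0, (fun i => (st i).1), (fun i => (st i).2), (fun i => (F (i, st i)).1).
split=> // i; have [_ [? ? ? ?]] := FP (i, st i) (inv_st i).
by have [? ?] := inv_st i; split.
Qed.

(** * Sequences with dyadically small increments *)

Lemma dyadic_dist (K : numFieldType) (X : normedModType K) (v : nat -> X)
    (j : nat) :
  (forall i, (j <= i)%N -> `|v i.+1 - v i| < 2^-1 ^+ i.+1) ->
  forall i, (j <= i)%N -> `|v i - v j| < 2^-1 ^+ j.
Proof.
move=> vS i ji.
(* Subtracting [2^-i] lets the bound absorb each new increment exactly. *)
suff H : `|v i - v j| <= 2^-1 ^+ j - 2^-1 ^+ i.
  by apply: (le_lt_trans H); rewrite gtrBl exprn_gt0// invr_gt0.
elim: i ji => [|i IH]; first by rewrite leqn0 => /eqP->; rewrite !subrr normr0.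
rewrite leq_eqVlt => /orP[/eqP<-|]; first by rewrite !subrr normr0.
rewrite ltnS => ji; have -> : v i.+1 - v j = (v i - v j) + (v i.+1 - v i).
  by rewrite [RHS]addrC addrA subrK.
apply: (le_trans (ler_normD _ _)).
apply: (le_trans (lerD (IH ji) (ltW (vS i ji)))).
by rewrite exprS le_eqVlt; apply/orP; left; apply/eqP; field.
Qed.

(** The first hypothesis is an archimedean property, which a general [numFieldType] may fail. *)
Lemma dyadic_cvg (K : numFieldType) (X : completeNormedModType K)
    (v : nat -> X) :
  (forall e : K, 0 < e -> exists n, 2^-1 ^+ n < e) ->
  (forall i, `|v i.+1 - v i| < 2^-1 ^+ i.+1) ->
  exists x : X, v @ \oo --> x.
Proof.
move=> arch vS; have : cauchy (v @ \oo).
  apply: cauchy_exP => e /arch[n ne]; exists (v n); exists n => // i /= ni.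
  rewrite -ball_normE /= distrC (lt_trans _ ne)//.
  by apply: dyadic_dist => // *; exact: vS.
by move/cauchy_cvgP => cv; exists (lim (v @ \oo)).
Qed.

Lemma dyadic_dist_lim (K : numFieldType) (X : normedModType K) (v : nat -> X)
    (x : X) (j : nat) :
  v @ \oo --> x ->
  (forall i, (j <= i)%N -> `|v i.+1 - v i| < 2^-1 ^+ i.+1) ->
  `|x - v j| < 2^-1 ^+ j + 2^-1 ^+ j.
Proof.
move=> vx vS.
have d0 : 0 < 2^-1 ^+ j :> K by rewrite exprn_gt0// invr_gt0.
have [n _ nP] : \forall i \near \oo, `|x - v i| < 2^-1 ^+ j.
  by move/cvgrPdist_lt: vx; exact.
have := nP (maxn n j) (leq_maxl _ _); have := dyadic_dist vS (leq_maxr n j).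
move=> H1 H2; rewrite -(subrK (v (maxn n j)) x) -addrA.
by rewrite (le_lt_trans (ler_normD _ _))// ltrD.
Qed.

(** * Target sequence and continuity at time 0 *)

(** The 2-adic valuation takes each value infinitely often, for instance [a] at every [2^a 3^n];
    composing it with an enumeration of the dense set repeats every point infinitely often. *)
Lemma dense_sequence_often (K : numFieldType) (X : normedModType K) :
  separable X -> exists u : nat -> X, forall U : set X, open U -> U !=set0 ->
    forall n, exists2 i, (n <= i)%N & U (u i.+1).
Proof.
move=> [D /countable_injP[f finj] Ddense].
pose d k := xget 0 [set x | D x /\ f x = k].
exists (fun i => d (logn 2 i)) => U oU U0 n.
have [x [Ux Dx]] := Ddense U U0 oU.
have dfx : d (f x) = x.
  rewrite /d; case: xgetP => [y _ [Dy fyx]|/(_ x)]; last by case.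
  by apply: finj; rewrite ?inE.
have gt0 : (0 < 2 ^ f x * 3 ^ n)%N by rewrite muln_gt0 !expn_gt0.
exists (2 ^ f x * 3 ^ n).-1.
  rewrite -ltnS prednK// (leq_trans (ltn_expl n (isT : 1 < 3)%N))//.
  by rewrite leq_pmull// expn_gt0.
rewrite prednK// lognM ?expn_gt0// pfactorK// lognX.
by rewrite (_ : logn 2 3 = 0%N)// muln0 addn0 dfx.
Qed.

Lemma C0_right_continuous (R : realType) (K : numFieldType)
    (X : normedModType K) (T : R -> {linear X -> X}) :
  is_C0_semigroup T -> forall (z : X) (e : K), 0 < e ->
  exists2 r : R, 0 < r & forall s, 0 <= s < r -> `|T s z - z| < e.
Proof.
move=> C0 z e e0; pose A := [set t : R | 0 <= t].
have A0 : A 0 by rewrite /A/=.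
have : (fun t => T t z) @ within A (nbhs 0) --> T 0 z.
  by rewrite (nbhs_subspace_in A0); exact: (@C0_continuous _ _ _ _ C0 z 0).
move=> /cvgrPdist_lt/(_ _ e0); rewrite (C0_id C0) => -[r /= r0 rP].
exists r => // s /andP[s0 sr]; rewrite distrC; apply: rP => //=.
by rewrite sub0r normrN ger0_norm.
Qed.

(** * The limit vector is frequently hypercyclic *)

Lemma SgSP_frequently_hypercyclic (R : realType) (K : numFieldType)
    (X : completeNormedModType K) (T : R -> {linear X -> X}) :
  (forall e : K, 0 < e -> exists n, 2^-1 ^+ n < e) ->
  separable X -> is_C0_semigroup T -> SgSP T -> frequently_hypercyclic T.
Proof.
move=> arch /dense_sequence_often[u udense] C0 /(periodic_approximants u C0).
move=> [t0 [z [p [N [t0_gt0 H]]]]].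
have NpS i : (0 < N i)%N /\ p i.+1 = (2 ^ i.+3 * N i)%N.
  by case: (H i) => -[? _] [_ ?].
have p0 i : (0 < p i)%N by case: (H i) => _ [].
have pz i : T ((p i)%:R * t0) (z i) = z i by case: (H i).
have small i t : 0 <= t <= ((2 ^ i.+3).-2 * N i)%:R * t0 ->
    `|T t (z i.+1 - z i)| < 2^-1 ^+ i.+1 by case: (H i) => _ _ _ _; exact.
have dvdS i : (p i %| p i.+1)%N.
  by case: (H i) => -[_ pN] [_ ->] _ _ _; rewrite dvdn_mull.
have dvdp i j : (i <= j)%N -> (p i %| p j)%N.
  elim: j => [|j IH]; first by rewrite leqn0 => /eqP->.
  by rewrite leq_eqVlt => /orP[/eqP->//|/IH /dvdn_trans]; apply.
have t0_ge0 := ltW t0_gt0.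
have [x zx] : exists x : X, z @ \oo --> x.
  apply: dyadic_cvg => // i; rewrite -(C0_id C0 (z i.+1 - z i)).
  by apply: small; rewrite lexx mulr_ge0.
exists x => U oU [y Uy].
have [e /= e0 ballU] : nbhs_ball y U by apply/nbhs_ballP; exact: open_nbhs_nbhs.
(* Half of [e] pays for [y - u j]; the rest pays for four errors [d]: two from the tail of the
   series, one from continuity, one from the hit. *)
have e80 : 0 < e / 8 by rewrite divr_gt0.
have [n0 n0e] := arch _ e80.
have e20 : 0 < e / 2 by rewrite divr_gt0.
have [i ni uy] :=
  udense _ (ball_open y (e / 2)) (ex_intro _ y (ballxx _ e20)) n0.
set j := i.+1 in uy; set d : K := 2^-1 ^+ j.
have d0 : 0 < d by rewrite exprn_gt0// invr_gt0.
have de : d < e / 8.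
  apply: le_lt_trans n0e; rewrite /d ler_wiXn2l ?invr_ge0//.
    by rewrite invf_le1 ?ler1n.
  by rewrite (leq_trans ni).
set h := (p j - N i)%N.
have [Ni0 pj] := NpS i.
have hp : (h < p j)%N by rewrite ltn_subrL Ni0 p0.
set g := T (h%:R * t0) (z j).
have gu : `|g - u j| < d by case: (H i).
have [r r0 gr] := C0_right_continuous C0 g d0.
have NjP l : (j <= l)%N -> (0 < N l)%N /\ (p j %| N l)%N.
  by move=> jl; case: (H l) => -[? /(dvdn_trans (dvdp _ _ jl)) ?] _ _ _ _.
pose good k := `[< forall l, (j <= l)%N ->
    ((h + k * p j) %% (2 ^ l.+3 * N l) < (2 ^ l.+3).-2 * N l)%N >].
(* Windows shorter than [r] keep [T s g] near [g]; shorter than [t0], they stay in one unit of time,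
   so the strict bound on integer residues in [good] suffices. *)
have eps0 : 0 < Num.min r t0 by rewrite lt_min r0.
apply: (@lower_density_gt0 _ _ ((p j)%:R * t0) (Num.min r t0)
  (fun k => (h + k * p j)%:R * t0) good) => //.
- by rewrite mulr_gt0// ltr0n.
- move=> k; split.
    by rewrite mulrA -natrM ler_wpM2r// ler_nat leq_addl.
  apply: (@le_trans _ _ ((h + k * p j)%:R * t0 + t0)).
    by rewrite lerD2l ge_min lexx orbT.
  rewrite mulrA -natrM -[X in _ + X]mul1r -mulrDl -(natrD _ _ 1) ler_wpM2r//.
  by rewrite ler_nat mulSn addnAC leq_add2r addn1.
- move=> k /asboolP goodk t; rewrite /= in_itv/= => /andP[wt tw].
  have a0 : 0 <= (h + k * p j)%:R * t0 by rewrite mulr_ge0.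
  have tt : 0 <= t := le_trans a0 wt.
  split=> //; apply: ballU; rewrite -ball_normE /=.
  set s := t - (h + k * p j)%:R * t0.
  have ts : t = s + (h + k * p j)%:R * t0 by rewrite subrK.
  have s0 : 0 <= s by rewrite subr_ge0.
  have [sr st] : s < r /\ s < t0.
    by apply/andP; rewrite -lt_min ltrBlDl.
  clearbody s.
  have Tt : T t (z j) = T s g.
    rewrite ts /g (C0_comp C0)// ?mulr_ge0// natrD mulrDl addrA natrM -mulrA.
    by apply: (C0_periodic C0 _ (pz j)); rewrite ?addr_ge0 ?mulr_ge0.
  (* The tail estimate is applied to the images [T t (z l)], which converge to [T t x] because [T t]
     is bounded. *)
  have Tx : `|T t x - T t (z j)| < d + d.
    apply: (dyadic_dist_lim (v := fun l => T t (z l))).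
      have /(_ x) cT := (linear_bounded_continuous (T t)).1 (C0_bounded C0 tt).
      exact: (cvg_comp _ _ zx cT).
    move=> l jl; have <- : T t (z l.+1 - z l) = T t (z l.+1) - T t (z l).
      by rewrite raddfB.
    set a := (h + k * p j)%N in ts a0 *.
    have gl := goodk l jl; rewrite -/a in gl.
    set P := (2 ^ l.+3 * N l)%N in gl.
    have PE : P = p l.+1 by have [_ ->] := NpS l.
    have zper : T (P%:R * t0) (z l.+1 - z l) = z l.+1 - z l.
      rewrite raddfB/= PE pz; have /dvdnP[c ->] := dvdS l.
      have := C0_periodic C0 _ (pz l) c (lexx 0).
      by rewrite add0r (C0_id C0) mulrA -natrM => ->//; rewrite mulr_ge0.
    (* Periodicity of the increment reduces [t] to its first period, where goodness puts it in the
       range of [small]. *)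
    have -> : t = (s + (a %% P)%:R * t0) + (a %/ P)%:R * (P%:R * t0).
      rewrite ts -addrA; congr (_ + _); rewrite mulrA -natrM -mulrDl -natrD.
      by rewrite addnC -divn_eq.
    have -> : T (s + (a %% P)%:R * t0 + (a %/ P)%:R * (P%:R * t0))
                (z l.+1 - z l)
        = T (s + (a %% P)%:R * t0) (z l.+1 - z l).
      by apply: (C0_periodic C0 _ zper); rewrite ?addr_ge0 ?mulr_ge0.
    apply: small; rewrite addr_ge0 ?mulr_ge0//=.
    apply: (@le_trans _ _ (t0 + (a %% P)%:R * t0)); first by rewrite lerD2r ltW.
    rewrite -[X in X + _]mul1r -mulrDl -(natrD _ 1) ler_wpM2r//.
    by rewrite ler_nat add1n.
  have Tg : `|T s g - g| < d by apply: gr; rewrite s0.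
  have -> : y - T t x =
      (y - u j) - ((T t x - T t (z j)) + (T s g - g) + (g - u j)).
    by rewrite Tt !subrKA opprB subrKA.
  apply: (le_lt_trans (ler_normB _ _)).
  have eE : e = e / 2 + (e / 8 + e / 8 + e / 8 + e / 8) by field.
  move: uy; rewrite -ball_normE /= => uy.
  rewrite eE ltrD// (le_lt_trans (ler_normD _ _))// ltrD//;
    last exact: lt_trans de.
  rewrite (le_lt_trans (ler_normD _ _))// ltrD//; last exact: lt_trans de.
  by rewrite (lt_trans Tx)// ltrD.
- exact: count_good_blocks.
Qed.

(** A positive complex number has zero imaginary part, so the complex case reduces to the real
    one. *)
Lemma scalar_field_half_exp_small (R : realType) (b : bool)
    (e : scalar_field R b) : 0 < e -> exists n, 2^-1 ^+ n < e.
Proof.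
have arch (r : R) : 0 < r -> exists n, 2^-1 ^+ n < r.
  move=> r0; have /archi_boundP : 0 <= r^-1 by rewrite invr_ge0 ltW.
  set n := Num.bound _ => rn; exists n; rewrite exprVn -[ltRHS]invrK.
  rewrite ltf_pV2 ?posrE ?invr_gt0 ?exprn_gt0// (lt_le_trans rn)//.
  by rewrite -natrX ler_nat ltnW// ltn_expl.
case: b e => /= e; last exact: arch.
case: e => a c; rewrite ltcE/= => /andP[/eqP c0 /arch[n na]]; exists n.
have -> : 2^-1 ^+ n = ((2^-1 ^+ n)%:C)%C :> R[i].
  by rewrite rmorphXn/= rmorphV/= ?unitfE ?pnatr_eq0// rmorph_nat.
by rewrite ltcE/= c0 eqxx.
Qed.

Theorem proposition10 (R : realType) (b : bool)
    (X : completeNormedModType (scalar_field R b))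
    (T : R -> {linear X -> X}) :
  separable X -> is_C0_semigroup T -> SgSP T -> frequently_hypercyclic T.
Proof.
exact/SgSP_frequently_hypercyclic/scalar_field_half_exp_small.
Qed.
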